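(* Any limiting policy $\phi^\ast$ of (non-discounted) Value Iteration, i.e. any pointwise limit point $\phi^\ast\in\Phi$ of the sequence of policies $(\phi_{0,n})_{n\ge1}$ produced by Value Iteration with $\alpha=0$ and $V_{0,0}\equiv0$, is strongly Blackwell optimal: there exists $\alpha'>0$ such that for all $0<\alpha<\alpha'$ and all $\phi\in\Phi$, $V^{\phi^\ast}_\alpha\le V^{\phi}_\alpha$ component-wise on $S$.
   Context: Model. Real parameters $\lambda,\beta>0$ and $0<\mu_1<\mu_2$ satisfy $\lambda+\mu_1+\mu_2+\beta=1$; service cost rates $0=c_{\mu_1}<c_{\mu_2}$; a fixed rate $\mu\in\{\mu_1,\mu_2\}$ with $\mu>\lambda$. The holding cost $h:\mathbb{N}_0\to\mathbb{R}$ satisfies $h(0)=0$, is non-negative, non-decreasing, convex (i.e. $h(i+1)-h(i)$ is non-decreasing in $i$), unbounded, and $\sum_{i\ge 0}h(i)x^i<\infty$ for all $0<x<1$. State space $S=\mathbb{N}_0\times\{0,1\}$. $\Phi$ is the set of stationary deterministic policies $\phi$, with $\phi(i,1)\in\{\mu_1,\mu_2\}$ and $\phi(i,0)=\mu$. Under $\phi$, the discrete-time Markov chain $(Y_n)$ on $S$ has the following transitions. From $(i,1)$ with $a=\phi(i,1)$: to $(i+1,1)$ w.p. $\lambda$, to $(i,0)$ w.p. $\beta$, to $(i-1,1)$ w.p. $a\mathbf 1_{\{i>0\}}$, to $(i,1)$ otherwise. From $(i,0)$: to $(i+1,0)$ w.p. $\lambda$, to $(i-1,0)$ w.p. $\mu\mathbf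 1_{\{i>0\}}$, to $(i,0)$ otherwise. One-step costs: $c^\phi(i,1)=c_{\phi(i,1)}+h(i)$, $c^\phi(i,0)=c_\mu+h(i)$. For $0<\alpha<1$, $V^\phi_\alpha(x)=\mathbb{E}^\phi_x\big[\sum_{n\ge0}(1-\alpha)^nc^\phi(Y_n)\big]$, $x\in S$. Write $i^+=\max\{i,0\}$. Value Iteration with $\alpha=0$: $V_{0,0}\equiv0$ and, for $n\ge0$, $$V_{0,n+1}(i,1)=h(i)+\mu_1V_{0,n}(i,1)+\mu_1V_{0,n}((i-1)^+,1)+\lambda V_{0,n}(i+1,1)+\beta V_{0,n}(i,0)+\min_{a\in\{\mu_1,\mu_2\}}\big\{c_a+(a-\mu_1)V_{0,n}((i-1)^+,1)+(\mu_2-a)V_{0,n}(i,1)\big\},$$ $$V_{0,n+1}(i,0)=c_\mu+h(i)+\mu V_{0,n}((i-1)^+,0)+(1-\mu-\lambda)V_{0,n}(i,0)+\lambda V_{0,n}(i+1,0).$$ $\phi_{0,n+1}(i,1)$ is the minimising action, ties being resolved in favour of $\mu_1$; equivalently $\phi_{0,n+1}(i,1)=\mu_1$ iff $V_{0,n}(i,1)-V_{0,n}((i-1)^+,1)\le\frac{c_{\mu_2}}{\mu_2-\mu_1}$. *)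

(* Defs.v *)
From HB Require Import structures.
From mathcomp Require Import all_boot all_order all_algebra.
From mathcomp Require Import all_classical all_reals all_analysis.
From mathcomp Require Import ring lra zify.
Set Implicit Arguments.
Unset Strict Implicit.
Unset Printing Implicit Defensive.
Import Order.TTheory GRing.Theory Num.Theory.
Import numFieldNormedType.Exports.
Local Open Scope classical_set_scope.
Local Open Scope ring_scope.

Record model (R : realType) := Model {
  lam : R;
  beta : R;
  mu1 : R;
  mu2 : R;
  mu : R;
  cost : R -> R; (* service cost rate [c_a]; only its values at [mu1], [mu2] matter *)
  hold : nat -> R;
  lam_gt0 : 0 < lam;
  beta_gt0 : 0 < beta;
  mu1_gt0 : 0 < mu1;
  mu1_lt_mu2 : mu1 < mu2;
  rates_sum1 : lam + mu1 + mu2 + beta = 1;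
  cost_mu1 : cost mu1 = 0;
  cost_mu2_gt0 : 0 < cost mu2;
  mu_choice : mu = mu1 \/ mu = mu2;
  lam_lt_mu : lam < mu;
  hold0 : hold 0 = 0;
  hold_ge0 : forall i, 0 <= hold i;
  hold_nondecr : forall i, hold i <= hold i.+1;
  hold_convex : forall i, hold i.+1 - hold i <= hold i.+2 - hold i.+1;
  hold_unbounded : forall M, exists i, M < hold i;
  hold_series : forall x, 0 < x < 1 -> cvgn (series (fun i => hold i * x ^+ i))
}.

(* [(i, true)] is the state (i,1) and [(i, false)] the state (i,0). *)
Definition state := (nat * bool)%type.

Section Model.
Context {R : realType} (m : model R).

Definition policy := state -> R.

Definition admissible (phi : policy) :=
  forall i, (phi (i, true) = mu1 m \/ phi (i, true) = mu2 m)
            /\ phi (i, false) = mu m.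

Definition trans (phi : policy) (s s' : state) : R :=
  let: (i, b) := s in
  let death := phi s * (0 < i)%:R in
  if b then
    lam m * (s' == (i.+1, true))%:R
    + beta m * (s' == (i, false))%:R
    + death * (s' == (i.-1, true))%:R
    + (1 - lam m - beta m - death) * (s' == (i, true))%:R
  else
    lam m * (s' == (i.+1, false))%:R
    + death * (s' == (i.-1, false))%:R
    + (1 - lam m - death) * (s' == (i, false))%:R.

Definition step_cost (phi : policy) (s : state) : R :=
  cost m (phi s) + hold m s.1.

End Model.

(* [Y] is a time-homogeneous Markov chain with transition probabilities [p]
   started at [x]. The Markov property is written in product form, so that no
   conditioning on null events occurs. *)
Record markov_chain (R : realType) (d : measure_display) (T : measurableType d)
    (P : probability T R) (p : state -> state -> R) (x : state)
    (Y : nat -> T -> state) : Prop := {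
  chain_measurable : forall n s, measurable (Y n @^-1` [set s]);
  chain_init : P (Y 0%N @^-1` [set x]) = 1%:E;
  chain_step : forall n (s : nat -> state),
    P [set w | forall k, (k <= n.+1)%N -> Y k w = s k] =
    (P [set w | forall k, (k <= n)%N -> Y k w = s k] * (p (s n) (s n.+1))%:E)%E
}.

Section Criterion.
Context {R : realType} (m : model R).

Definition discounted_cost (phi : policy) (alpha : R)
    (d : measure_display) (T : measurableType d) (P : probability T R)
    (Y : nat -> T -> state) : \bar R :=
  (\int[P]_w \sum_(0 <= n <oo) ((1 - alpha) ^+ n * step_cost m phi (Y n w))%:E)%E.

(* [discounted_value phi alpha x v] means v = V^phi_alpha(x); the value does not
   depend on the realisation of the chain, which exists by
   [markov_chain_exists] below. *)
Definition discounted_value (phi : policy) (alpha : R) (x : state) (v : \bar R) :=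
  exists (d : measure_display) (T : measurableType d) (P : probability T R)
         (Y : nat -> T -> state),
    markov_chain P (trans m phi) x Y /\ v = discounted_cost phi alpha P Y.

Definition strongly_blackwell_optimal (phistar : policy) :=
  exists2 alpha' : R, 0 < alpha' &
    forall alpha, 0 < alpha < 1 -> alpha < alpha' ->
    forall phi, admissible m phi ->
    forall x vstar v,
      discounted_value phistar alpha x vstar ->
      discounted_value phi alpha x v ->
      (vstar <= v)%E.

Definition action_term (V : state -> R) (i : nat) (a : R) : R :=
  cost m a + (a - mu1 m) * V (i.-1, true) + (mu2 m - a) * V (i, true).

Fixpoint vi (n : nat) (s : state) : R :=
  if n is n'.+1 then
    let: (i, b) := s in
    if b then
      hold m i + mu1 m * vi n' (i, true) + mu1 m * vi n' (i.-1, true)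
      + lam m * vi n' (i.+1, true) + beta m * vi n' (i, false)
      + Num.min (action_term (vi n') i (mu1 m)) (action_term (vi n') i (mu2 m))
    else
      cost m (mu m) + hold m i + mu m * vi n' (i.-1, false)
      + (1 - mu m - lam m) * vi n' (i, false) + lam m * vi n' (i.+1, false)
  else 0.

(* [vi_policy n] is phi_{0,n+1}, i.e. greedy with respect to [vi n]. *)
Definition vi_policy (n : nat) : policy := fun s =>
  let: (i, b) := s in
  if b then
    if action_term (vi n) i (mu1 m) <= action_term (vi n) i (mu2 m)
    then mu1 m else mu2 m
  else mu m.

(* Pointwise limit point: limit along a strictly increasing subsequence. *)
Definition vi_limit_policy (phi : policy) :=
  exists2 sub : nat -> nat, {homo sub : j k / (j < k)%N} &
    forall s, vi_policy (sub k) s @[k --> \oo] --> phi s.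

End Criterion.

(* Non-vacuity of [discounted_value]: chains with any transition function whose
   rows are finitely supported probability vectors exist. The chain is realised
   on ([0, 1], uniform) by splitting intervals according to [p]. *)
Section Existence.
Context {R : realType} (p : state -> state -> R) (x : state).

Let q (s : state) (j : nat) : R :=
  if pickle_inv j is Some s' then p s s' else 0.
Let F (s : state) (k : nat) : R := \sum_(0 <= j < k) q s j.

Hypothesis p_ge0 : forall s s', 0 <= p s s'.
Hypothesis p_sum1 : forall s, exists K, forall k, (K <= k)%N -> F s k = 1.

Let q_ge0 s j : 0 <= q s j.
Proof. by rewrite /q; case: pickle_inv. Qed.

Let qE s s' : q s (pickle s') = p s s'.
Proof. by rewrite /q pickleK_inv. Qed.

Let FS s k : F s k.+1 = F s k + q s k.
Proof. by rewrite /F big_nat_recr. Qed.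

Let F0 s : F s 0 = 0.
Proof. by rewrite /F big_geq. Qed.

Let F_mono s k k' : (k <= k')%N -> F s k <= F s k'.
Proof.
move=> /subnK <-; elim: (k' - k)%N => [|n ih]; first by rewrite add0n.
by rewrite addSn FS (le_trans ih)// lerDl.
Qed.

Let F_ge0 s k : 0 <= F s k.
Proof. by rewrite -(F0 s) F_mono. Qed.

Let F_le1 s k : F s k <= 1.
Proof.
have [K HK] := p_sum1 s.
by rewrite -(HK (maxn K k)) ?leq_maxl// F_mono ?leq_maxr.
Qed.

Let cell (s : state) (a l w : R) : set nat :=
  [set k | a + l * F s k <= w < a + l * F s k.+1].

Let cell_ex s a l w : 0 <= l -> a <= w < a + l -> exists k, cell s a l w k.
Proof.
move=> l0 /andP[aw wl].
have [K HK] := p_sum1 s.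
have exk : exists k, w < a + l * F s k by exists K; rewrite HK// mulr1.
case: (ex_minnP exk) => -[|k].
  by rewrite F0 mulr0 addr0 ltNge aw.
move=> wk min; exists k; rewrite /cell/= wk andbT leNgt; apply/negP => /min.
by rewrite ltnn.
Qed.

Let cell_uniq s a l w k k' : 0 <= l ->
  cell s a l w k -> cell s a l w k' -> k = k'.
Proof.
move=> l0.
have H i j : cell s a l w i -> cell s a l w j -> (i <= j)%N.
  move=> /andP[ci _] /andP[_ cj]; rewrite leqNgt; apply/negP => ji.
  have Fji : a + l * F s j.+1 <= a + l * F s i.
    by rewrite lerD2l ler_wpM2l// F_mono.
  by have := lt_le_trans cj (le_trans Fji ci); rewrite ltxx.
by move=> ck ck'; apply/eqP; rewrite eqn_leq !H.
Qed.

Let next (w : R) (u : state * R * R) : state * R * R :=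
  let: (s, a, l) := u in
  let k := xget 0%N (cell s a l w) in
  (odflt s (pickle_inv k), a + l * F s k, l * q s k).

Let tr w n := iter n (next w) (x, 0, 1).

Let Y n w := if 0 <= w < 1 then (tr w n).1.1 else x.

Section Path.
Variable s : nat -> state.

Fixpoint path_len (n : nat) : R :=
  if n is n'.+1 then path_len n' * p (s n') (s n'.+1) else (s 0 == x)%:R.

Fixpoint path_left (n : nat) : R :=
  if n is n'.+1 then
    path_left n' + path_len n' * \sum_(0 <= j < pickle (s n'.+1)) q (s n') j
  else 0.

Let A := path_left.
Let L := path_len.

Let L_ge0 n : 0 <= L n.
Proof. by elim: n => [|n ih] /=; [rewrite ler0n|rewrite mulr_ge0]. Qed.

Let AS n : A n.+1 = A n + L n * F (s n) (pickle (s n.+1)).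
Proof. by []. Qed.

Let ALS n : A n.+1 + L n.+1 = A n + L n * F (s n) (pickle (s n.+1)).+1.
Proof. by rewrite AS FS qE mulrDr addrA. Qed.

Let A_nest n : A n <= A n.+1 /\ A n.+1 + L n.+1 <= A n + L n.
Proof.
rewrite ALS AS; split; first by rewrite lerDl mulr_ge0.
by rewrite lerD2l ler_piMr.
Qed.

Let AL01 n : 0 <= A n /\ A n + L n <= 1.
Proof.
elim: n => [|n [h1 h2]]; first by rewrite /A /L/= add0r; case: eqP.
by have [h3 h4] := A_nest n; rewrite (le_trans h1 h3) (le_trans h4 h2).
Qed.

Let path_fwd n w : 0 <= w < 1 -> (forall k, (k <= n)%N -> Y k w = s k) ->
  tr w n = (s n, A n, L n) /\ A n <= w < A n + L n.
Proof.
move=> w01; elim: n => [|n ih] h.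
  have := h 0%N (leqnn _); rewrite /Y w01/= => xs.
  by rewrite /A /L/= -xs eqxx add0r.
have [|e cw] := ih; first by move=> k kn; apply: h; rewrite ltnW.
have [k0 ck0] := cell_ex (s n) (L_ge0 n) cw.
have := h n.+1 (leqnn _); rewrite /Y w01 /tr iterS -/(tr w n) e /=.
have : cell (s n) (A n) (L n) w (xget 0%N (cell (s n) (A n) (L n) w)).
  by apply: xgetPex; exists k0.
move: (xget _ _) => k ck.
have qk : q (s n) k != 0.
  apply/eqP => qk; move: ck; rewrite /cell/= FS qk addr0 => /andP[/le_lt_trans].
  by move=> /[apply]; rewrite ltxx.
move: qk; rewrite {1}/q.
case E : (pickle_inv k) => [t|]; last by rewrite eqxx.
move=> _ /= ts.
have Ek : k = pickle (s n.+1).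
  by have := @pickle_invK (nat * bool)%type k; rewrite /oapp E ts.
move: ck; rewrite /cell/= Ek -AS -ALS => ck; split => //.
by rewrite ts qE.
Qed.

Let path_bwd n w : A n <= w < A n + L n -> forall k, (k <= n)%N -> Y k w = s k.
Proof.
elim: n => [|n ih] cw k.
  have w01 : 0 <= w < 1.
    have [h1 h2] := AL01 0; move: cw => /andP[c1 c2].
    by rewrite (le_trans h1 c1) (lt_le_trans c2 h2).
  rewrite leqn0 => /eqP ->; rewrite /Y w01 /=.
  move: cw; rewrite /A /L/=; case: (s 0 =P x) => //= _.
  by rewrite addr0 => /andP[/le_lt_trans /[apply]]; rewrite ltxx.
have w01 : 0 <= w < 1.
  have [h1 h2] := AL01 n.+1; move: cw => /andP[c1 c2].
  by rewrite (le_trans h1 c1) (lt_le_trans c2 h2).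
have cw' : A n <= w < A n + L n.
  have [h1 h2] := A_nest n; move: cw => /andP[c1 c2].
  by rewrite (le_trans h1 c1) (lt_le_trans c2 h2).
rewrite leq_eqVlt => /predU1P[->|]; last exact: ih.
have [e _] := path_fwd w01 (ih cw').
rewrite /Y w01 /tr iterS -/(tr w n) e /=.
have c1 : cell (s n) (A n) (L n) w (pickle (s n.+1)).
  by rewrite /cell/= -AS -ALS.
have c2 : cell (s n) (A n) (L n) w (xget 0%N (cell (s n) (A n) (L n) w)).
  by apply: xgetPex; exists (pickle (s n.+1)).
by rewrite (cell_uniq (L_ge0 n) c2 c1) pickleK_inv.
Qed.

Let event n : set (measurableTypeR R) :=
  [set w | forall k, (k <= n)%N -> Y k w = s k].

Let event_in n : event n `&` `[0, 1[ = `[A n, A n + L n[%classic.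
Proof.
apply/seteqP; split => w; rewrite /event/= !in_itv/=.
  by move=> [h w01]; have [] := path_fwd w01 h.
move=> cw; split; first exact: path_bwd.
have [h1 h2] := AL01 n; move: cw => /andP[c1 c2].
by rewrite (le_trans h1 c1) (lt_le_trans c2 h2).
Qed.

Let event_split n : event n = `[A n, A n + L n[%classic `|`
  (if `[< forall k, (k <= n)%N -> x = s k >] then ~` `[0, 1[%classic else set0).
Proof.
rewrite -event_in; apply/seteqP; split => w /=.
  move=> h; have [w01|w01] := pselect (`[0, 1[%classic w); first by left.
  right; rewrite asboolT// => k kn; rewrite -(h k kn) /Y.
  by case: ifPn => // w01'; exfalso; apply: w01; rewrite /= in_itv.
case=> [[ew _]|]; first exact: ew.
case: asboolP => [xs w01 k kn|_ []].
by rewrite -xs// /Y; case: ifPn => // w01'; exfalso; apply: w01; rewrite /= in_itv.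
Qed.

Lemma path_event_measurable n : measurable (event n).
Proof.
rewrite event_split; apply: measurableU; first exact: measurable_itv.
by case: ifPn => _ //; apply: measurableC; exact: measurable_itv.
Qed.

Let itv_prob (a b : R) : 0 <= a -> a <= b -> b <= 1 ->
  uniform_prob (@ltr01 R) `[a, b[%classic = (b - a)%:E.
Proof.
move=> a0 ab b1; rewrite /uniform_prob (eq_integral (cst 1%:E)); last first.
  move=> w; rewrite inE/= in_itv/= => /andP[c1 c2].
  rewrite /uniform_pdf subr0 invr1 ifT//.
  by rewrite (le_trans a0 c1) (le_trans (ltW c2) b1).
rewrite integral_cst//= mul1e lebesgue_measure_itv/= lte_fin.
move: ab; rewrite le_eqVlt => /predU1P[->|->//].
by rewrite ltxx subrr.
Qed.

Lemma path_event_prob n :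
  uniform_prob (@ltr01 R) (event n) = (L n)%:E.
Proof.
have [h1 h2] := AL01 n.
rewrite event_split measureU0.
- transitivity (A n + L n - A n)%:E; last by rewrite addrAC subrr add0r.
  by apply: itv_prob; rewrite // lerDl.
- exact: measurable_itv.
- by case: ifPn => _ //; apply: measurableC; exact: measurable_itv.
- case: ifPn => _; last exact: measure0.
  have mI : measurable (`[0, 1[%classic : set (measurableTypeR R)).
    exact: measurable_itv.
  apply: etrans (probability_setC (uniform_prob (@ltr01 R)) mI) _.
  rewrite (_ : _ `[0, 1[%classic = 1%E) ?subee//.
  by apply: etrans (itv_prob _ _ _) _; rewrite ?subr0.
Qed.

End Path.

Lemma markov_chain_from_rows :
  exists (P : probability (measurableTypeR R) R)
         (Z : nat -> measurableTypeR R -> state), markov_chain P p x Z.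
Proof.
exists (uniform_prob (@ltr01 R)), Y; split.
- move=> n s.
  have -> : Y n @^-1` [set s] = \bigcup_(r : seq state)
      if nth x r n == s then
        [set w | forall k, (k <= n)%N -> Y k w = nth x r k] else set0.
    apply/seteqP; split => w /=.
      move=> Ys; exists (mkseq (fun k => Y k w) n.+1) => //.
      rewrite nth_mkseq// Ys eqxx => k kn.
      by rewrite nth_mkseq.
    by move=> [r _]; case: eqP => // <- /(_ n (leqnn _)).
  apply: countable_bigcupT_measurable; first exact: countableP.
  by move=> r; case: ifP => _ //; exact: path_event_measurable.
- have := path_event_prob (fun=> x) 0; rewrite /= eqxx => <-.
  congr (uniform_prob _ _); apply/seteqP; split => w /= h.
    by move=> k; rewrite leqn0 => /eqP ->.
  exact: h.
- move=> n s; apply: etrans (path_event_prob s n.+1) _; rewrite /= EFinM.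
  by congr (_ * _)%E; exact: esym (path_event_prob s n).
Qed.

End Existence.

Lemma markov_chain_exists (R : realType) (m : model R) (phi : policy) (x : state) :
  admissible m phi ->
  exists (P : probability (measurableTypeR R) R)
         (Y : nat -> measurableTypeR R -> state),
    markov_chain P (trans m phi) x Y.
Proof.
move=> adm.
have := lam_gt0 m; have := beta_gt0 m; have := mu1_gt0 m.
have := mu1_lt_mu2 m; have := rates_sum1 m => sum1 mu12 mu10 b0 l0.
apply: markov_chain_from_rows => [[i b] s'|[i b]].
  have [h1 h2] := adm i.
  have phi_bnd : 0 <= phi (i, b) /\ phi (i, b) <= mu2 m.
    case: b; first by case: h1 => ->; split; lra.
    by rewrite h2; case: (mu_choice m) => ->; split; lra.
  have [p0 p1] := phi_bnd.
  have d1 : phi (i, b) * (0 < i)%:R <= mu2 m.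
    by case: (0 < i)%N; rewrite ?mulr1 ?mulr0//; lra.
  by case: b p0 p1 d1 {phi_bnd} => p0 p1 d1 /=; rewrite !addr_ge0 ?mulr_ge0 ?ler0n//; lra.
have ind (K : nat) (c : R) (t : state) : (pickle t < K)%N ->
    \sum_(0 <= j < K) c * (j == pickle t)%:R = c.
  move=> tK; rewrite big_mkord (bigD1 (Ordinal tK))//= eqxx mulr1 big1 ?addr0//.
  by move=> j; rewrite -val_eqE/= => /negbTE ->; rewrite mulr0.
have pk (j : nat) (t : state) (c : R) :
    (if pickle_inv j is Some s' then c * (s' == t)%:R else 0)
    = c * (j == pickle t)%:R.
  have := @pickle_invK (nat * bool)%type j; rewrite /oapp.
  case E : (pickle_inv j) => [u|].
    by move=> <-; rewrite (inj_eq (pcan_inj pickleK)).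
  move=> _; case: eqP => [ej|]; last by rewrite mulr0.
  by move: E; rewrite ej pickleK_inv.
pose K := (pickle (i.+1, b) + pickle (i, false) + pickle (i.-1, b)
           + pickle (i, b)).+1.
exists K => k Kk.
transitivity (\sum_(0 <= j < k) (
    lam m * (j == pickle (i.+1, b))%:R
    + b%:R * beta m * (j == pickle (i, false))%:R
    + phi (i, b) * (0 < i)%:R * (j == pickle (i.-1, b))%:R
    + (1 - lam m - b%:R * beta m - phi (i, b) * (0 < i)%:R)
       * (j == pickle (i, b))%:R)).
  apply: eq_bigr => j _; rewrite -!pk.
  case: pickle_inv => [u|]; last by rewrite !addr0.
  by case: b {K Kk} => /=; rewrite ?mul1r ?mul0r ?addr0 ?subr0.
rewrite !big_split/= !ind; first by ring.
all: apply: leq_trans Kk; rewrite /K ltnS; lia.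
Qed.

(* Main.v *)
(** Let W_{g,n} be the n-th Value Iteration function with discount factor g.
    Its first differences in i satisfy a recursion that is monotone in all its
    entries, so they are non-decreasing in n, in i and in g. Let N be the least
    i at which some undiscounted difference exceeds c_{mu2} / (mu2 - mu1). Then
    phi* uses mu1 below N and mu2 from N on (mu1 everywhere if there is no N).
    Below N, monotonicity in g makes mu1 greedy for every W_{g,n}, ties
    included. At N, some n0 exceeds the bound strictly at g = 1, hence, by
    continuity, for g near 1, and monotonicity in n and i propagates this to
    all n >= n0 and i >= N. So phi* is greedy for W_{g,n} for all n >= n0,
    whence its k-step cost is at most W_{g,n0+k}, which is at most the
    (n0+k)-step cost of any policy, hence at most its discounted value; let k
    tend to infinity. *)
Require Import Defs.
From mathcomp Require Import all_boot all_order all_algebra.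
From mathcomp Require Import all_classical all_reals all_analysis.
From mathcomp Require Import measurable_realfun ring lra.
Set Implicit Arguments.
Unset Strict Implicit.
Unset Printing Implicit Defensive.
Import Order.TTheory GRing.Theory Num.Theory.
Import numFieldNormedType.Exports.
Local Open Scope classical_set_scope.
Local Open Scope ring_scope.

(** * Discounted Value Iteration and finite-horizon policy costs *)

Section ValueIteration.
Context {R : realType} (m : model R).
Implicit Types (g : R) (phi : state -> R) (V : state -> R) (i n : nat).

Definition bellman V (s : state) : R :=
  let: (i, b) := s in
  if b then
    hold m i + mu1 m * V (i, true) + mu1 m * V (i.-1, true)
    + lam m * V (i.+1, true) + beta m * V (i, false)
    + Num.min (action_term m V i (mu1 m)) (action_term m V i (mu2 m))
  else
    cost m (mu m) + hold m i + mu m * V (i.-1, false)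
    + (1 - mu m - lam m) * V (i, false) + lam m * V (i.+1, false).

(** The discount is applied to the argument of [bellman], so one operator serves every g, and g = 1
    gives back [vi]. *)
Fixpoint dvi g n : state -> R :=
  if n is n'.+1 then bellman (fun s => g * dvi g n' s) else fun=> 0.

Lemma dvi1 n : dvi 1 n = vi m n.
Proof.
elim: n => [//|n ih]; rewrite [LHS]/= ih.
have -> : (fun s => 1 * vi m n s) = vi m n by apply/funext => s; rewrite mul1r.
by apply/funext => -[i b].
Qed.

Definition expect_next phi V (s : state) : R :=
  let: (i, b) := s in
  let death := phi s * (0 < i)%:R in
  if b then
    lam m * V (i.+1, true) + beta m * V (i, false) + death * V (i.-1, true)
    + (1 - lam m - beta m - death) * V (i, true)
  else
    lam m * V (i.+1, false) + death * V (i.-1, false)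
    + (1 - lam m - death) * V (i, false).

Fixpoint policy_cost phi g n (s : state) : R :=
  if n is n'.+1 then
    step_cost m phi s + g * expect_next phi (policy_cost phi g n') s
  else 0.

(** The bound [mu2] keeps the self-loop probability at least [mu1], since the rates sum to 1. *)
Lemma admissible_death phi s : admissible m phi ->
  0 <= phi s * (0 < s.1)%:R /\ phi s * (0 < s.1)%:R <= mu2 m.
Proof.
case: s => i b /(_ i)[h1 h2].
have := mu1_gt0 m; have := mu1_lt_mu2 m => mu12 mu10.
have [p0 p1] : 0 <= phi (i, b) /\ phi (i, b) <= mu2 m.
  case: b; first by case: h1 => ->; split; lra.
  by rewrite h2; case: (mu_choice m) => ->; split; lra.
by case: (0 < i)%N; rewrite ?mulr1 ?mulr0//=; split; lra.
Qed.

Lemma expect_next_le phi V V' s : admissible m phi ->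
  (forall t, V t <= V' t) -> expect_next phi V s <= expect_next phi V' s.
Proof.
move=> adm VV'; have [] := admissible_death s adm.
have := lam_gt0 m; have := beta_gt0 m; have := mu1_gt0 m.
have := rates_sum1 m => sum1 mu10 b0 l0.
case: s => i [] /= d0 d1; rewrite !lerD// ler_wpM2l//; lra.
Qed.

Lemma expect_next_ge0 phi V s : admissible m phi ->
  (forall t, 0 <= V t) -> 0 <= expect_next phi V s.
Proof.
move=> adm /(expect_next_le s adm); apply: le_trans.
by case: s => i []; rewrite /= !mulr0 !addr0.
Qed.

Lemma step_cost_ge0 phi s : admissible m phi -> 0 <= step_cost m phi s.
Proof.
case: s => i b /(_ i)[h1 h2]; apply: addr_ge0; last exact: hold_ge0.
have c1 : 0 <= cost m (mu1 m) by rewrite cost_mu1.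
have c2 := ltW (cost_mu2_gt0 m).
case: b; first by case: h1 => ->.
by rewrite h2; case: (mu_choice m) => ->.
Qed.

Lemma policy_cost_ge0 phi g n s : admissible m phi -> 0 <= g ->
  0 <= policy_cost phi g n s.
Proof.
move=> adm g0; elim: n s => [//|n ih] s /=.
by rewrite addr_ge0 ?step_cost_ge0// mulr_ge0// expect_next_ge0.
Qed.

(** Uniformisation: as the rates sum to 1, the weights on (i,1) add up to the self-loop probability.
    At i = 0, [0.-1 = 0] turns service of an empty queue into a self-loop. *)
Lemma action_split phi g V i :
  hold m i + mu1 m * (g * V (i, true)) + mu1 m * (g * V (i.-1, true))
  + lam m * (g * V (i.+1, true)) + beta m * (g * V (i, false))
  + action_term m (fun s => g * V s) i (phi (i, true))
  = step_cost m phi (i, true) + g * expect_next phi V (i, true).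
Proof.
rewrite /action_term /step_cost /=.
have -> : mu2 m = 1 - lam m - mu1 m - beta m by rewrite -(rates_sum1 m); ring.
by case: i => [|i] /=; ring.
Qed.

Lemma bellman_le phi g V s : admissible m phi ->
  bellman (fun t => g * V t) s <= step_cost m phi s + g * expect_next phi V s.
Proof.
case: s => i [] adm; last first.
  rewrite /step_cost /= (adm i).2 le_eqVlt; apply/orP; left; apply/eqP.
  by case: i => [|i] /=; ring.
rewrite -action_split /= lerD2l ge_min.
by case: (adm i).1 => ->; rewrite lexx ?orbT.
Qed.

Lemma dvi_le_policy_cost phi g n s : admissible m phi -> 0 <= g ->
  dvi g n s <= policy_cost phi g n s.
Proof.
move=> adm g0; elim: n s => [//|n ih] s /=.
apply: le_trans (bellman_le _ _ _ adm) _.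
by rewrite lerD2l ler_wpM2l// expect_next_le.
Qed.

(** * Greedy policies and first differences in i *)

Definition ddiff g n (b : bool) i : R := dvi g n (i, b) - dvi g n (i.-1, b).

Lemma action_leE g V i :
  (action_term m (fun s => g * V s) i (mu1 m)
   <= action_term m (fun s => g * V s) i (mu2 m))
  = ((mu2 m - mu1 m) * (g * (V (i, true) - V (i.-1, true))) <= cost m (mu2 m)).
Proof.
rewrite /action_term cost_mu1 -subr_ge0 -[RHS]subr_ge0; congr (0 <= _); ring.
Qed.

Definition greedy phi g n i :=
  phi (i, true) = if (mu2 m - mu1 m) * (g * ddiff g n true i) <= cost m (mu2 m)
                  then mu1 m else mu2 m.

Lemma bellman_greedy phi g n s : admissible m phi ->
  (forall i, greedy phi g n i) ->
  dvi g n.+1 s = step_cost m phi s + g * expect_next phi (dvi g n) s.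
Proof.
case: s => i [] adm gr; last first.
  by rewrite /step_cost /= (adm i).2; case: i => [|i] /=; ring.
rewrite -action_split /=; congr (_ + _).
rewrite (gr i) /ddiff -action_leE.
case: ifPn => [h|]; first by rewrite min_l.
by rewrite -ltNge => /ltW h; rewrite min_r.
Qed.

Lemma dvi_ge0 g n s : 0 <= g -> 0 <= dvi g n s.
Proof.
move=> g0; elim: n s => [//|n ih] [i b].
have := lam_gt0 m; have := beta_gt0 m; have := mu1_gt0 m.
have := rates_sum1 m; have := mu1_lt_mu2 m => mu12 sum1 mu10 b0 l0.
have c2 := cost_mu2_gt0 m; have h0 := hold_ge0 m i.
have [cmu0 mu0 mu0'] : [/\ 0 <= cost m (mu m), 0 <= mu m & mu m <= mu2 m].
  by case: (mu_choice m) => ->; rewrite ?cost_mu1; split; lra.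
have gih t : 0 <= g * dvi g n t by rewrite mulr_ge0.
case: b => /=; last by rewrite !addr_ge0 ?mulr_ge0//; lra.
rewrite /action_term cost_mu1 !addr_ge0 ?mulr_ge0//; try lra.
by rewrite le_min !addr_ge0 ?mulr_ge0//; lra.
Qed.

(** Under greediness the right side is the k-step cost of [phi] with terminal cost [dvi g n0], which
    is non-negative; [policy_cost] has terminal cost 0. *)
Lemma policy_cost_le_dvi phi g n0 k s : admissible m phi -> 0 <= g ->
  (forall n i, (n0 <= n)%N -> greedy phi g n i) ->
  policy_cost phi g k s <= dvi g (n0 + k)%N s.
Proof.
move=> adm g0 gr; elim: k s => [|k ih] s; first exact: dvi_ge0.
rewrite addnS (bellman_greedy _ adm); last by move=> i; apply: gr; exact: leq_addr.
by rewrite lerD2l ler_wpM2l// expect_next_le.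
Qed.

(* The minimum in the Bellman operator contributes, with K = c_{mu2} and
   e = mu2 - mu1, the difference of the terms e V(i) + min(0, K - e d(i)), namely
   min(e d(i+1), K) + max(e d(i) - K, 0), which is monotone in both d's. *)
Definition diff_step (b : bool) (dh x y z w : R) : R :=
  if b then
    dh + (mu1 m * y + mu1 m * x + lam m * z + beta m * w)
    + (Num.min ((mu2 m - mu1 m) * y) (cost m (mu2 m))
       + Num.max ((mu2 m - mu1 m) * x - cost m (mu2 m)) 0)
  else dh + (mu m * x + (1 - mu m - lam m) * y + lam m * z).

Lemma ddiffS g n b i :
  ddiff g n.+1 b i.+1 =
  diff_step b (hold m i.+1 - hold m i) (g * ddiff g n b i) (g * ddiff g n b i.+1)
    (g * ddiff g n b i.+2) (g * ddiff g n false i.+1).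
Proof.
rewrite /ddiff /diff_step; case: b => /=; last by case: i => [|i] /=; ring.
rewrite /action_term cost_mu1.
set C := cost m (mu2 m); set d := mu2 m - mu1 m.
set u := dvi g n (i.+1, true); set v := dvi g n (i, true).
set w := dvi g n (i.-1, true).
(* Each minimum is taken relative to the value at the lower state. The difference is then min(e
   d(i+1), K) - min(e d(i), K) + e d(i), and [maxE] turns the last two terms into a positive
   part. *)
have minE a c : Num.min (0 + (mu1 m - mu1 m) * (g * a) + d * (g * c))
    (C + d * (g * a) + (mu2 m - mu2 m) * (g * c))
    = d * (g * a) + Num.min (d * (g * (c - a))) C.
  by rewrite addr_minr; congr Num.min; ring.
rewrite !minE.
have maxE a : Num.max (a - C) 0 = a - Num.min a C.
  by rewrite minElt maxElt subr_lt0; case: ltP => _; rewrite ?subrr.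
rewrite maxE; ring.
Qed.

Lemma diff_step_le b dh dh' x x' y y' z z' w w' :
  dh <= dh' -> x <= x' -> y <= y' -> z <= z' -> w <= w' ->
  diff_step b dh x y z w <= diff_step b dh' x' y' z' w'.
Proof.
have := lam_gt0 m; have := beta_gt0 m; have := mu1_gt0 m.
have := rates_sum1 m; have := mu1_lt_mu2 m => mu12 sum1 mu10 b0 l0.
have [mu0 mu0'] : 0 <= mu m /\ mu m <= mu2 m.
  by case: (mu_choice m) => ->; split; lra.
move=> hdh hx hy hz hw.
have dx : (mu2 m - mu1 m) * x <= (mu2 m - mu1 m) * x' by rewrite ler_wpM2l//; lra.
have dy : (mu2 m - mu1 m) * y <= (mu2 m - mu1 m) * y' by rewrite ler_wpM2l//; lra.
case: b => /=; last by rewrite !lerD// ler_wpM2l//; lra.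
rewrite !lerD ?ler_wpM2l//; try lra.
  by rewrite le_min !ge_min dy lexx orbT.
by rewrite ge_max !le_max lexx lerD2r dx orbT.
Qed.

Lemma hold_diff_le i l :
  hold m i.+1 - hold m i <= hold m (i + l).+1 - hold m (i + l).
Proof.
elim: l => [|l ih]; first by rewrite addn0.
by rewrite addnS (le_trans ih)// hold_convex.
Qed.

Lemma ddiff0 g n b : ddiff g n b 0 = 0.
Proof. by rewrite /ddiff subrr. Qed.

Lemma ddiff_ge0 g n b i : 0 <= g -> 0 <= ddiff g n b i.
Proof.
move=> g0; elim: n b i => [|n ih] b i; first by rewrite /ddiff subrr.
case: i => [|i]; first by rewrite ddiff0.
(* Zero is a fixed point of the recursion without holding cost, so monotonicity of [diff_step] gives
   the sign. *)
have -> : 0 = diff_step b 0 0 0 0 0.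
  have := ltW (cost_mu2_gt0 m) => c2.
  rewrite /diff_step !mulr0 !addr0 !add0r; case: b => //.
  by rewrite min_l// max_r ?addr0// oppr_le0.
by rewrite ddiffS diff_step_le ?mulr_ge0// subr_ge0 hold_nondecr.
Qed.

(** One induction on n moves all three parameters at once; convexity of [hold] handles the shift l
    in the inhomogeneous term. At n = 0 and at i = 0 the left side vanishes and [ddiff_ge0]
    suffices. *)
Lemma ddiff_le g g' n k l b i : 0 <= g -> g <= g' ->
  ddiff g n b i <= ddiff g' (n + k)%N b (i + l)%N.
Proof.
move=> g0 gg'; have g'0 := le_trans g0 gg'.
elim: n b i => [|n ih] b i; first by rewrite {1}/ddiff subrr ddiff_ge0.
case: i => [|i]; first by rewrite ddiff0 ddiff_ge0.
rewrite !addSn !ddiffS diff_step_le ?hold_diff_le//.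
all: by rewrite -?addSn ler_pM// ddiff_ge0.
Qed.

(** * Limit policies are greedy for discount factors near 1 *)

Lemma dvi_continuous n s : continuous (fun g => dvi g n s).
Proof.
elim: n s => [|n ih] s g /=; first exact: cvg_cst.
have cc c : (c : R) @[x --> g] --> c by exact: cvg_cst.
have gc t c : (c * (x * dvi x n t)) @[x --> g] --> c * (g * dvi g n t).
  by apply: cvgM => //; apply: cvgM; [exact: cvg_id|exact: ih].
case: s => i [] /=; last by do 3 (apply: cvgD => //).
apply: cvgD; first by do 4 (apply: cvgD => //).
by apply: (@continuous_min R R _ _ g) => /=; do 2 (apply: cvgD => //).
Qed.

(** Since k <= [sub k], an action that is constant from n0 on is eventually constant along the
    subsequence, hence equal to the limit. *)
Lemma limit_policy_action phi n0 i a : vi_limit_policy m phi ->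
  (forall n, (n0 <= n)%N -> vi_policy m n (i, true) = a) -> phi (i, true) = a.
Proof.
move=> [sub sub_mono lim_phi] eq_a.
have sub_ge k : (k <= sub k)%N.
  by elim: k => // k ih; exact: leq_ltn_trans ih (sub_mono _ _ (leqnn _)).
rewrite -(cvg_lim (@Rhausdorff R) (lim_phi (i, true))).
apply: (lim_near_cst (@Rhausdorff R)); exists n0 => // k /= kn.
by apply: eq_a; exact: leq_trans kn (sub_ge k).
Qed.

Lemma vi_policyE n i : vi_policy m n (i, true) =
  if (mu2 m - mu1 m) * ddiff 1 n true i <= cost m (mu2 m)
  then mu1 m else mu2 m.
Proof.
rewrite /vi_policy -dvi1 -[ddiff _ _ _ _]mul1r -action_leE.
by have -> : (fun s => 1 * dvi 1 n s) = dvi 1 n by apply/funext => s; rewrite mul1r.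
Qed.

Lemma limit_policy_greedy phi : vi_limit_policy m phi ->
  exists2 alpha', 0 < alpha' & exists n0, forall alpha n i,
    0 < alpha < 1 -> alpha < alpha' -> (n0 <= n)%N -> greedy phi (1 - alpha) n i.
Proof.
move=> lim_phi; have mu12 : 0 < mu2 m - mu1 m by rewrite subr_gt0 mu1_lt_mu2.
pose above i := exists n, cost m (mu2 m) < (mu2 m - mu1 m) * ddiff 1 n true i.
have below_greedy i alpha n : 0 < alpha < 1 -> ~ above i ->
    greedy phi (1 - alpha) n i.
  move=> a01 nab.
  have le_c k : (mu2 m - mu1 m) * ddiff 1 k true i <= cost m (mu2 m).
    by rewrite leNgt; apply/negP => lt_c; apply: nab; exists k.
  rewrite /greedy (@limit_policy_action _ 0 i (mu1 m) lim_phi).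
    rewrite ifT// (le_trans _ (le_c n))// ler_pM2l//.
    have d0 : 0 <= ddiff (1 - alpha) n true i by apply: ddiff_ge0; lra.
    (* First the outer factor 1 - alpha is dropped, then the discount factor inside the difference
       is raised to 1. *)
    apply: (@le_trans _ _ (ddiff (1 - alpha) n true i)).
      by rewrite ler_piMl//; lra.
    by rewrite -{2}[n]addn0 -{2}[i]addn0 ddiff_le//; lra.
  by move=> k _; rewrite vi_policyE le_c.
have [exN|noN] := pselect (exists N, above N); last first.
  (* Without such an N, every alpha in (0,1) works. *)
  exists 1 => //; exists 0%N => alpha n i a01 _ _; apply: below_greedy => // ab.
  by apply: noN; exists i.
have exN' : exists N, `[< above N >].
  by have [N aN] := exN; exists N; apply/asboolP.
case: (ex_minnP exN') => N /asboolP[n0 aN] minN.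
have lim1 : ((mu2 m - mu1 m) * (g * ddiff g n0 true N)) @[g --> (1 : R)] -->
    (mu2 m - mu1 m) * (1 * ddiff 1 n0 true N).
  apply: cvgM; first exact: cvg_cst.
  by apply: cvgM; [exact: cvg_id|apply: cvgB; exact: dvi_continuous].
have : \forall g \near (1 : R),
    cost m (mu2 m) < (mu2 m - mu1 m) * (g * ddiff g n0 true N).
  by apply: (cvgr_gt _ lim1); rewrite mul1r.
(* The radius serves as alpha', because 1 - alpha lies at distance alpha from 1. *)
move=> /nbhs_ballP[e /= e0 near1]; exists e => //; exists n0.
move=> alpha n i a01 ae n0n.
have [iN|Ni] := ltnP i N.
  apply: below_greedy => // /asboolP/minN.
  by rewrite leqNgt iN.
(* Used with g = 1 - alpha for the greedy action and with g = 1 for the action of [phi]. *)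
have up k g : (n0 <= k)%N -> 0 <= g ->
    cost m (mu2 m) < (mu2 m - mu1 m) * (g * ddiff g n0 true N) ->
    cost m (mu2 m) < (mu2 m - mu1 m) * (g * ddiff g k true i).
  move=> n0k g0 /lt_le_trans; apply; rewrite ler_pM2l// ler_wpM2l//.
  by rewrite -(subnKC n0k) -(subnKC Ni) ddiff_le.
rewrite /greedy (@limit_policy_action _ n0 i (mu2 m) lim_phi).
  rewrite ifF//; apply/negbTE; rewrite -ltNge; apply: up => //; first lra.
  by apply: near1; rewrite /ball/= opprB addrC subrK ger0_norm//; lra.
move=> k n0k; rewrite vi_policyE ifF//; apply/negbTE; rewrite -ltNge.
by rewrite -[ddiff _ _ _ _]mul1r up// mul1r.
Qed.

End ValueIteration.

(** * From finite-horizon costs to expected discounted costs of the chain *)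

Section ChainCost.
Context {R : realType} (m : model R) (phi : state -> R).
Hypothesis phi_adm : admissible m phi.

(** A row has at most four targets, so the partial sums are constant once all their codes have been
    passed. *)
Lemma trans_sum (V : state -> R) s : exists K, forall k, (K <= k)%N ->
  \sum_(0 <= j < k)
    (if pickle_inv j is Some t then trans m phi s t * V t else 0)
  = expect_next m phi V s.
Proof.
have ind (K : nat) (c : R) (t : state) : (pickle t < K)%N ->
    \sum_(0 <= j < K) c * V t * (j == pickle t)%:R = c * V t.
  move=> tK; rewrite big_mkord (bigD1 (Ordinal tK))//= eqxx mulr1 big1 ?addr0//.
  by move=> j; rewrite -val_eqE/= => /negbTE ->; rewrite mulr0.
have pk (j : nat) (t : state) (c : R) :
    c * V t * (j == pickle t)%:R
    = if pickle_inv j is Some u then c * (u == t)%:R * V u else 0.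
  have := @pickle_invK state j; rewrite /oapp.
  case E : (pickle_inv j) => [u|].
    move=> <-; rewrite (inj_eq (pcan_inj pickleK)).
    by case: eqP => [->|_]; rewrite ?mulr1 // !mulr0 mul0r.
  move=> _; case: eqP => [ej|]; last by rewrite mulr0.
  by move: E; rewrite ej pickleK_inv.
case: s => i b.
exists (maxn (maxn (pickle (i.+1, b)) (pickle (i, false)))
             (maxn (pickle (i.-1, b)) (pickle (i, b)))).+1 => k.
rewrite !gtn_max => /andP[/andP[k1 k2] /andP[k3 k4]].
(* The factor [b%:R] lets one formula cover both layers: it removes the jump at rate [beta] when b
   is false. *)
transitivity (\sum_(0 <= j < k) (
    lam m * V (i.+1, b) * (j == pickle (i.+1, b))%:R
    + b%:R * beta m * V (i, false) * (j == pickle (i, false))%:R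
    + phi (i, b) * (0 < i)%:R * V (i.-1, b) * (j == pickle (i.-1, b))%:R
    + (1 - lam m - b%:R * beta m - phi (i, b) * (0 < i)%:R) * V (i, b)
      * (j == pickle (i, b))%:R)).
  apply: eq_bigr => j _; rewrite !pk.
  case: pickle_inv => [u|]; last by rewrite !addr0.
  by rewrite -!mulrDl; case: b {k1 k3 k4} => /=; rewrite ?mul1r ?mul0r ?addr0 ?subr0.
rewrite !big_split/= !ind//.
by case: b {k1 k3 k4} => /=; rewrite ?mul1r ?mul0r ?addr0 ?subr0.
Qed.

Lemma trans_eseries (c : R) (V : state -> R) s :
  (\sum_(0 <= j <oo) (c *
    (if pickle_inv j is Some t then trans m phi s t * V t else 0))%:E)%E
  = (c * expect_next m phi V s)%:E.
Proof.
have [K HK] := trans_sum V s.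
apply: lim_near_cst; first exact: ereal_hausdorff.
by exists K => // k /= Kk; rewrite sumEFin -mulr_sumr HK.
Qed.

Context {d : measure_display} {T : measurableType d} (P : probability T R).
Context (x : state) (Y : nat -> T -> state).
Hypothesis chainY : markov_chain P (trans m phi) x Y.
Context (g : R).
Hypothesis g_ge0 : 0 <= g.

(** The state space is countable, so every preimage is a countable union of fibres of [Y n]. *)
Lemma measurable_chain_fun n (f : state -> \bar R) :
  measurable_fun setT (f \o Y n).
Proof.
move=> _ B mB; rewrite setTI.
have -> : (f \o Y n) @^-1` B =
    \bigcup_(s : state) (if f s \in B then Y n @^-1` [set s] else set0).
  apply/seteqP; split => w /=; first by move=> Bw; exists (Y n w); rewrite ?mem_set.
  by move=> [s _]; case: ifPn => // /set_mem Bs ->.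
apply: countable_bigcupT_measurable; first exact: countableP.
by move=> s; case: ifP => _ //; exact: chain_measurable chainY _ _.
Qed.

Definition path_event n (s : nat -> state) : set T :=
  [set w | forall k, (k <= n)%N -> Y k w = s k].

Lemma measurable_path_event n s : measurable (path_event n s).
Proof.
have -> : path_event n s =
    \bigcap_k (if (k <= n)%N then Y k @^-1` [set s k] else setT).
  apply/seteqP; split => w /= h k; first by move=> _; case: ifP => // /h.
  by move=> kn; have := h k I; rewrite kn.
apply: bigcapT_measurable => k.
by case: ifP => _ //; exact: chain_measurable chainY _ _.
Qed.

Definition upd (s : nat -> state) n t k := if k == n then t else s k.

Lemma path_event_upd n s t : path_event n (upd s n.+1 t) = path_event n s.
Proof.
by apply/seteqP; split => w h k kn; have := h k kn; rewrite /upd ltn_eqF.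
Qed.

(** Indexing by codes instead of states makes the partition a sequence, as countable additivity
    needs. *)
Definition next_event n s j : set T :=
  if pickle_inv j is Some t then path_event n.+1 (upd s n.+1 t) else set0.

Lemma bigcup_next_event n s : \bigcup_j next_event n s j = path_event n s.
Proof.
apply/seteqP; split => w.
  move=> [j _]; rewrite /next_event; case: pickle_inv => // t h.
  by rewrite -(path_event_upd n s t) => k kn; apply: h; exact: ltnW.
move=> h; exists (pickle (Y n.+1 w)) => //.
rewrite /next_event pickleK_inv => k; rewrite /upd.
by case: eqP => [->//|/eqP kn]; rewrite leq_eqVlt (negbTE kn) => /h.
Qed.

Lemma trivIset_next_event n s : trivIset setT (next_event n s).
Proof.
move=> j j' _ _ [w []]; rewrite /next_event.
have := @pickle_invK state j; have := @pickle_invK state j'; rewrite /oapp.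
case: pickle_inv => // t' <-; case: pickle_inv => // t <-.
by move=> /(_ _ (leqnn _)) + /(_ _ (leqnn _)); rewrite /upd eqxx => -> ->.
Qed.

Lemma measurable_next_event n s j : measurable (next_event n s j).
Proof.
by rewrite /next_event; case: pickle_inv => // t; exact: measurable_path_event.
Qed.

(** Discounting restarts at time j, which lets the recursion [run_costS] close. *)
Definition run_cost n j w : \bar R :=
  (\sum_(k < n) (g ^+ k * step_cost m phi (Y (j + k) w))%:E)%E.

Lemma run_cost_ge0 n j w : (0 <= run_cost n j w)%E.
Proof.
by apply: sume_ge0 => k _; rewrite lee_fin mulr_ge0 ?exprn_ge0// step_cost_ge0.
Qed.

Lemma measurable_run_cost n j : measurable_fun setT (run_cost n j).
Proof.
apply: emeasurable_sum => k _.
exact: (measurable_chain_fun _ (fun s => (g ^+ k * step_cost m phi s)%:E)).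
Qed.

Lemma run_costS n j w : run_cost n.+1 j w =
  ((step_cost m phi (Y j w))%:E + g%:E * run_cost n j.+1 w)%E.
Proof.
rewrite /run_cost big_ord_recl expr0 mul1r addn0; congr (_ + _)%E.
rewrite ge0_sume_distrr => [|k _]; last first.
  by rewrite lee_fin mulr_ge0 ?exprn_ge0// step_cost_ge0.
by apply: eq_bigr => k _; rewrite -EFinM mulrA -exprS addnS addSn.
Qed.

(** Induction on the horizon, splitting by the next state. The event fixes the whole history because
    [chain_step] speaks of complete initial paths. *)
Lemma integral_path_event n j s :
  (\int[P]_(w in path_event j s) run_cost n j w =
   P (path_event j s) * (policy_cost m phi g n (s j))%:E)%E.
Proof.
elim: n j s => [|n ih] j s.
  rewrite mule0 -[RHS](integral0 P (path_event j s)); apply: eq_integral => w _.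
  by rewrite /run_cost big_ord0.
have mE := measurable_path_event j s.
have mF : measurable_fun (path_event j s) (run_cost n j.+1).
  exact: measurable_funS (measurable_run_cost n j.+1).
transitivity (\int[P]_(w in path_event j s)
    ((cst (step_cost m phi (s j))%:E w) + g%:E * run_cost n j.+1 w))%E.
  apply: eq_integral => w /set_mem h.
  by rewrite run_costS (h _ (leqnn j)).
rewrite ge0_integralD//; first last.
- exact: measurable_funeM.
- by move=> w _; rewrite mule_ge0 ?run_cost_ge0// lee_fin.
- by move=> w _; rewrite lee_fin step_cost_ge0.
rewrite integral_cst// ge0_integralZl_EFin//; last first.
  by move=> w _; exact: run_cost_ge0.
(* Only the integral of the remaining cost is split; the first cost is constant on the event. *)
rewrite -{2}(bigcup_next_event j s) ge0_integral_bigcup; first last.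
- exact: trivIset_next_event.
- by move=> w _; exact: run_cost_ge0.
- by rewrite bigcup_next_event.
- exact: measurable_next_event.
have PE : P (path_event j s) \is a fin_num by exact: fin_num_measure.
rewrite -(fineK PE); set q := fine _.
transitivity ((step_cost m phi (s j) * q)%:E +
    g%:E * \sum_(0 <= i <oo) (q * (if pickle_inv i is Some t
       then trans m phi (s j) t * policy_cost m phi g n t else 0))%:E)%E.
  congr (_ + _ * _)%E; first by rewrite EFinM fineK.
  apply: eq_eseriesr => i _; rewrite /next_event.
  case: pickle_inv => [t|]; last by rewrite integral_set0 mulr0.
  rewrite ih [X in (X * _)%E](chain_step chainY) -/(path_event _ _).
  rewrite path_event_upd /upd eqxx (ltn_eqF (ltnSn j)) -(fineK PE) -/q.
  by rewrite -!EFinM mulrA.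
rewrite trans_eseries -!EFinM -EFinD; congr EFin => /=; ring.
Qed.

(** The event of starting at [x] has probability 1, so its complement contributes nothing. *)
Lemma expected_run_cost n :
  (\int[P]_w run_cost n 0 w = (policy_cost m phi g n x)%:E)%E.
Proof.
have mE := measurable_path_event 0 (fun=> x).
have E0 : path_event 0 (fun=> x) = Y 0%N @^-1` [set x].
  apply/seteqP; split => w /= h; first exact: h.
  by move=> k; rewrite leqn0 => /eqP ->.
have PE : P (path_event 0 (fun=> x)) = 1%:E by rewrite E0; exact: chain_init chainY.
have mC : measurable (~` path_event 0 (fun=> x)) by exact: measurableC.
have PC : P (~` path_event 0 (fun=> x)) = 0%E.
  by rewrite [LHS](probability_setC P mE) [X in (_ - X)%E]PE subee.
rewrite -[RHS]mul1e -PE -(integral_path_event n 0 (fun=> x)).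
have mF := measurable_run_cost n 0.
rewrite -{1}(setUv (path_event 0 (fun=> x))) ge0_integral_setU//.
- rewrite (null_set_integral mC _ PC) ?adde0//.
  exact: measurable_funS mF.
- by rewrite setUv.
- by move=> w _; exact: run_cost_ge0.
- by apply/disj_setPCl.
Qed.

Lemma policy_cost_le_discounted n : ((policy_cost m phi g n x)%:E <=
  \int[P]_w \sum_(0 <= k <oo) (g ^+ k * step_cost m phi (Y k w))%:E)%E.
Proof.
rewrite -expected_run_cost.
have c0 k w : (0 <= (g ^+ k * step_cost m phi (Y k w))%:E)%E.
  by rewrite lee_fin mulr_ge0 ?exprn_ge0// step_cost_ge0.
apply: ge0_le_integral => //.
- by move=> w _; exact: run_cost_ge0.
- exact: measurable_run_cost.
- apply: (ge0_emeasurable_sum (P := xpredT)) => [k w _ _|k _]; first exact: c0.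
  exact: (measurable_chain_fun _ (fun s => (g ^+ k * step_cost m phi s)%:E)).
- move=> w _; rewrite /run_cost.
  rewrite -(big_mkord xpredT (fun k => (g ^+ k * step_cost m phi (Y k w))%:E)).
  exact: nneseries_lim_ge.
Qed.

(** Non-negative terms may be integrated one by one, and the partial sums of the resulting series
    are the finite-horizon costs. *)
Lemma discounted_le_bound v : (forall n, ((policy_cost m phi g n x)%:E <= v)%E) ->
  (\int[P]_w \sum_(0 <= k <oo) (g ^+ k * step_cost m phi (Y k w))%:E <= v)%E.
Proof.
move=> le_v.
have c0 k w : (0 <= (g ^+ k * step_cost m phi (Y k w))%:E)%E.
  by rewrite lee_fin mulr_ge0 ?exprn_ge0// step_cost_ge0.
have mc k : measurable_fun setT (fun w => (g ^+ k * step_cost m phi (Y k w))%:E).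
  exact: (measurable_chain_fun _ (fun s => (g ^+ k * step_cost m phi s)%:E)).
rewrite integral_nneseries//; apply: lime_le.
  by apply: is_cvg_nneseries => k _ _; exact: integral_ge0.
apply: nearW => n; rewrite -ge0_integral_sum//.
rewrite (_ : (fun w => _) = run_cost n 0) ?expected_run_cost//.
by apply/funext => w; rewrite big_mkord.
Qed.

End ChainCost.

Theorem proposition3p4 (R : realType) (m : model R) (phistar : state -> R) :
  admissible m phistar ->
  vi_limit_policy m phistar ->
  strongly_blackwell_optimal m phistar.
Proof.
move=> adm_star /limit_policy_greedy[alpha' alpha'0 [n0 gr]].
exists alpha' => // alpha a01 aa' phi adm x vstar v.
have g0 : 0 <= 1 - alpha by lra.
move=> [d [T [P [Y [chainY ->]]]]] [d' [T' [P' [Y' [chainY' ->]]]]].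
apply: (discounted_le_bound adm_star chainY g0) => k.
(* The competitor runs n0 steps longer, so that both costs are compared with the same iterate, of
   index n0 + k. *)
apply: le_trans (policy_cost_le_discounted adm chainY' g0 (n0 + k)).
rewrite lee_fin (le_trans _ (dvi_le_policy_cost _ _ adm g0))//.
by apply: policy_cost_le_dvi => // n i; exact: gr.
Qed.
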